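(* The Killing-max property holds for the root system $D_n$: for all $\lambda,Y\in\overline{\mathfrak a^+}$ and all $w\in W$, $$\langle\lambda,w\cdot Y\rangle=\langle\lambda,Y\rangle\iff w\in W_\lambda\,W_Y .$$
   Context: For the root system $D_n$ ($n\ge2$): $\mathfrak a=\mathbb R^n$, $W$ acts by permuting the entries and changing an even number of signs, $\overline{\mathfrak a^+}=\{x\in\mathbb R^n:x_1\ge x_2\ge\dots\ge x_{n-1}\ge|x_n|\}$ is the closed positive Weyl chamber, and $\langle\cdot,\cdot\rangle$ is the $W$-invariant scalar product (the Killing form, a positive multiple of the standard scalar product). For $X\in\mathfrak a$, $W_X=\{w\in W:w\cdot X=X\}$; $W_\lambda W_Y=\{uv:u\in W_\lambda,v\in W_Y\}$. *)

(* Defs.v *)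
From mathcomp Require Import all_boot all_order all_algebra all_fingroup.
From mathcomp Require Import classical_sets reals.
Set Implicit Arguments.
Unset Strict Implicit.
Unset Printing Implicit Defensive.
Import Order.TTheory GRing.Theory Num.Theory.
Local Open Scope ring_scope.
Local Open Scope classical_set_scope.

(* The Cartan subspace R^n is 'cV[R]_n, and the Weyl group is a set of matrices
   acting by left multiplication, so that the product of W is [*m]. *)

(* (signed_perm_mx e s *m x) i = (if i \in e then -1 else 1) * x (s i) *)
Definition signed_perm_mx (R : realType) (n : nat) (e : {set 'I_n}) (s : 'S_n)
  : 'M[R]_n :=
  diag_mx (\row_i (-1) ^+ (i \in e)) *m perm_mx s.

Definition weylD (R : realType) (n : nat) : set 'M[R]_n :=
  [set w | exists (e : {set 'I_n}) (s : 'S_n),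
     ~~ odd #|e| /\ w = signed_perm_mx R e s].

(* Coordinates are numbered from 0, so the last one, the only one taken in
   absolute value, is the one of index j with j.+1 = n. *)
Definition closed_chamberD (R : realType) (n : nat) : set 'cV[R]_n :=
  [set x | forall i j : 'I_n, j = i.+1 :> nat ->
     (if j.+1 == n then `|x j 0| else x j 0) <= x i 0].

(* The Killing form is c times the standard scalar product, for some c > 0
   depending on normalizations; c is left as a parameter. *)
Definition killing_form (R : realType) (n : nat) (c : R) (x y : 'cV[R]_n) : R :=
  c * \sum_i x i 0 * y i 0.

Definition weylD_stab (R : realType) (n : nat) (x : 'cV[R]_n) : set 'M[R]_n :=
  [set w | weylD w /\ w *m x = x].

Definition mulmx_set (R : realType) (n : nat) (A B : set 'M[R]_n)
  : set 'M[R]_n :=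
  [set u *m v | u in A & v in B].

(* Main.v *)
Require Import Defs.
From mathcomp Require Import all_boot all_order all_algebra all_fingroup.
From mathcomp Require Import ring.
From mathcomp Require Import classical_sets reals.
Set Implicit Arguments.
Unset Strict Implicit.
Unset Printing Implicit Defensive.
Import Order.TTheory GRing.Theory Num.Theory.
Local Open Scope ring_scope.
Local Open Scope classical_set_scope.

(* If z in the orbit W.Y maximizes <lambda, .> over the orbit, then some u in
   W_lambda makes u z dominant, and Y is the only dominant point of its orbit,
   so u z = Y. Applied to an arbitrary maximizer, this shows that Y is one. Hence
   <lambda, w Y> = <lambda, Y> makes w Y one too, and u w Y = Y with u in W_lambda
   gives w = u^-1 (u w). *)

(** * The Weyl group as a group of orthogonal matrices *)

Lemma signed_perm_mxE (R : realType) n (e : {set 'I_n}) (s : 'S_n)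
    (x : 'cV[R]_n) i :
  (signed_perm_mx R e s *m x) i 0 = (-1) ^+ (i \in e) * x (s i) 0.
Proof.
by rewrite /signed_perm_mx -mulmxA mul_diag_mx -row_permE !mxE.
Qed.

(* Sign vectors with product 1 instead of even subsets: closure under products
   and transposes then needs no parity count of symmetric differences. *)
Lemma weylDP (R : realType) n (w : 'M[R]_n) :
  weylD w <-> exists (a : 'rV[R]_n) (s : 'S_n),
    [/\ forall i, a 0 i ^+ 2 = 1, \prod_i a 0 i = 1
      & w = diag_mx a *m perm_mx s].
Proof.
split=> [[e [s [even_e ->]]]|[a [s [a_sq a_prod ->]]]].
  exists (\row_i (-1) ^+ (i \in e)), s; split=> // [i|].
    by rewrite mxE sqrr_sign.
  under eq_bigr do rewrite mxE.
  rewrite (bigID (mem e)) /= [X in _ * X]big1 ?mulr1; last first.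
    by move=> i /negbTE->.
  rewrite (eq_bigr (fun=> -1)); last by move=> i ->.
  by rewrite prodr_const -signr_odd (negbTE even_e).
have a_sign i : a 0 i = (-1) ^+ (a 0 i == -1).
  have /eqP := a_sq i; rewrite sqrf_eq1 => /orP[]/eqP->; rewrite ?eqxx //.
  by rewrite eq_sym eqNr oner_eq0.
exists [set i | a 0 i == -1]%SET, s; split.
  move: a_prod; rewrite (bigID (fun i => a 0 i == -1)) /=.
  rewrite [X in _ * X]big1 ?mulr1; last first.
    by move=> i /negbTE h; rewrite a_sign h.
  rewrite (eq_bigr (fun=> -1)); last by move=> i /eqP.
  rewrite prodr_const -signr_odd -cardsE; case: odd => // /eqP.
  by rewrite eqNr oner_eq0.
rewrite /signed_perm_mx; congr (diag_mx _ *m _).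
by apply/rowP => i; rewrite !mxE inE.
Qed.

Lemma weylD1 (R : realType) n : weylD (1%:M : 'M[R]_n).
Proof.
apply/weylDP; exists (const_mx 1), 1%g; split=> [i||].
- by rewrite mxE expr1n.
- by rewrite big1 // => i; rewrite mxE.
- by rewrite perm_mx1 mulmx1 diag_const_mx.
Qed.

Lemma weylDM (R : realType) n (u v : 'M[R]_n) :
  weylD u -> weylD v -> weylD (u *m v).
Proof.
move=> /weylDP[a [s [a_sq a_prod ->]]] /weylDP[b [t [b_sq b_prod ->]]].
(* Moving [perm_mx s] past [diag_mx b] permutes the entries of [b] by [s]. *)
apply/weylDP; exists (\row_i (a 0 i * b 0 (s i))), (s * t)%g; split=> [i||].
- by rewrite mxE exprMn a_sq b_sq mulr1.
- under eq_bigr do rewrite mxE.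
  rewrite big_split /= a_prod mul1r -[RHS]b_prod.
  by rewrite [RHS](reindex_inj (@perm_inj _ s)).
- rewrite perm_mxM !mulmxA; congr (_ *m _).
  rewrite -!mulmxA -row_permE; apply/matrixP => i j.
  rewrite !mul_diag_mx !mxE.
  rewrite -mulrA; congr (_ * _).
  by case: (s i == j); rewrite ?mulr0 ?mulr1.
Qed.

Lemma weylD_trmxK (R : realType) n (w : 'M[R]_n) :
  weylD w -> w *m w^T = 1%:M.
Proof.
move=> /weylDP[a [s [a_sq _ ->]]].
rewrite trmx_mul tr_diag_mx tr_perm_mx mulmxA -(mulmxA _ (perm_mx s)).
rewrite -perm_mxM mulgV perm_mx1 mulmx1 mulmx_diag -diag_const_mx.
by congr diag_mx; apply/rowP => i; rewrite !mxE -expr2 a_sq.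
Qed.

Lemma weylD_trmxV (R : realType) n (w : 'M[R]_n) :
  weylD w -> w^T *m w = 1%:M.
Proof. by move=> /weylD_trmxK/mulmx1C. Qed.

Lemma weylD_tr (R : realType) n (w : 'M[R]_n) : weylD w -> weylD w^T.
Proof.
move=> /weylDP[a [s [a_sq a_prod ->]]].
apply/weylDP; exists (\row_i a 0 ((s^-1)%g i)), (s^-1)%g; split=> [i||].
- by rewrite mxE a_sq.
- under eq_bigr do rewrite mxE.
  by rewrite -[RHS]a_prod [RHS](reindex_inj (@perm_inj _ (s^-1)%g)).
- rewrite trmx_mul tr_diag_mx tr_perm_mx -row_permE.
  apply/matrixP => i j; rewrite mul_diag_mx !mxE.
  by case: eqP => [->|]; rewrite ?mulr1 ?mulr0.
Qed.

(** * Adjoints for the form and maximizers over the group *)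

Lemma killing_form_tr (R : realType) n (c : R) (w : 'M[R]_n) (x y : 'cV[R]_n) :
  killing_form c (w *m x) y = killing_form c x (w^T *m y).
Proof.
have killE u v : killing_form c u v = c * (u^T *m v) 0 0 :> R.
  by rewrite /killing_form mxE; congr (_ * _); apply: eq_bigr => i; rewrite mxE.
by rewrite !killE trmx_mul mulmxA.
Qed.

(** The group is only a set of matrices; the maximum is taken over the finite type of pairs [(e, s)]
    that parametrize it. The predicate [P] allows restricting to a stabilizer. *)
Lemma weylD_argmax (R : realType) n (P : pred 'M[R]_n) (f : 'M[R]_n -> R) w0 :
    weylD w0 -> P w0 ->
  exists w, [/\ weylD w, P w & forall v, weylD v -> P v -> f v <= f w].
Proof.
move=> [e0 [s0 [even0 ->]]] P0.
pose T := ({set 'I_n} * 'S_n)%type.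
pose m (t : T) := signed_perm_mx R t.1 t.2.
pose Q (t : T) := ~~ odd #|t.1| && P (m t).
have Q0 : Q (e0, s0) by rewrite /Q /= even0.
case: (arg_maxP (fun t => f (m t)) Q0) => t /andP[even_t Pt] maxt.
exists (m t); split=> // [|v [e [s [even_e ->]]] Pv]; first by exists t.1, t.2.
by apply: (maxt (e, s)); rewrite /Q /= even_e.
Qed.

(* The reflection in the root e_i - e_j (b = false) or e_i + e_j (b = true). *)
Definition reflD (R : realType) n (b : bool) (i j : 'I_n) : 'M[R]_n :=
  signed_perm_mx R (if b then [set i; j]%SET else finset.set0) (tperm i j).

(** * Action of the root reflections *)

Section Reflection.
Variables (R : realType) (n : nat) (b : bool) (i j : 'I_n).
Hypothesis neq_ij : i != j.

Lemma weylD_reflD : weylD (reflD R b i j).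
Proof.
exists (if b then [set i; j]%SET else finset.set0), (tperm i j); split=> //.
by case: (b); rewrite ?cards0 ?cards2 ?neq_ij.
Qed.

Lemma reflDE (x : 'cV[R]_n) k : (reflD R b i j *m x) k 0 =
  if k == i then (-1) ^+ b * x j 0
  else if k == j then (-1) ^+ b * x i 0 else x k 0.
Proof.
rewrite signed_perm_mxE permE /=.
by case: (b); rewrite !inE; case: (k == i); case: (k == j);
  rewrite /= ?expr0 ?mul1r.
Qed.

Lemma reflD_fix (x : 'cV[R]_n) :
  x i 0 = (-1) ^+ b * x j 0 -> reflD R b i j *m x = x.
Proof.
move=> xij; apply/colP => k; rewrite reflDE.
case: eqP => [->//|_]; case: eqP => [->|//].
by rewrite xij mulrA -expr2 sqrr_sign mul1r.
Qed.

(** For the root a = e_i - (-1)^b e_j, of standard square norm 2, the reflection sends y to y -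
    (y.a) a, so the form drops by c (x.a)(y.a). *)
Lemma killing_form_reflD (c : R) (x y : 'cV[R]_n) :
  killing_form c x (reflD R b i j *m y) = killing_form c x y
    - c * ((x i 0 - (-1) ^+ b * x j 0) * (y i 0 - (-1) ^+ b * y j 0)).
Proof.
rewrite /killing_form (bigD1 i) // (bigD1 j) /=; last by rewrite eq_sym.
rewrite [in RHS](bigD1 i) // [in RHS](bigD1 j) /=; last by rewrite eq_sym.
rewrite (eq_bigr (fun k => x k 0 * y k 0)); last first.
  by move=> k /andP[/negbTE ki /negbTE kj]; rewrite reflDE ki kj.
rewrite !reflDE !eqxx (eq_sym j) (negbTE neq_ij).
have := sqrr_sign R b; move: ((-1) ^+ b) (\sum_(_ | _) _) => t r tt.
(* [ring] does not know that [t] is a sign, so the expansion isolates [t ^+ 2], which [tt] turns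
   into 1. *)
have -> : (x i 0 - t * x j 0) * (y i 0 - t * y j 0) =
   x i 0 * y i 0 + t ^+ 2 * (x j 0 * y j 0)
   - t * (x i 0 * y j 0) - t * (x j 0 * y i 0) by ring.
by rewrite tt; ring.
Qed.

End Reflection.

(** * Dominant vectors and their uniqueness in an orbit *)

(** Splitting the absolute value turns the chamber into nonnegativity on the simple roots: e_i - e_j
    for consecutive indices, and e_i + e_j for the last two. The sign [b] matches that of
    [reflD]. *)
Lemma closed_chamberDP (R : realType) n (x : 'cV[R]_n) :
  closed_chamberD x <-> forall (i j : 'I_n) (b : bool), j = i.+1 :> nat ->
    (b -> j.+1 = n) -> (-1) ^+ b * x j 0 <= x i 0.
Proof.
split=> [dx i j b ij bj|dx i j ij].
  have := dx i j ij; case: b bj => [/(_ isT)/eqP->|_].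
    by rewrite expr1 mulN1r ler_norml => /andP[]; rewrite lerNl.
  by rewrite mul1r; case: ifP => // _; apply: le_trans (ler_norm _).
have := dx i j false ij; rewrite mul1r => /(_ (fun h => False_ind _ (notF h))).
case: eqP => // jn xji; rewrite ler_norml xji andbT lerNl.
by have := dx i j true ij; rewrite expr1 mulN1r; apply.
Qed.

(** The coordinates decrease down to the last but one, which dominates an absolute value. *)
Lemma closed_chamberD_ge0 (R : realType) n (x : 'cV[R]_n) (i : 'I_n) :
  closed_chamberD x -> (i.+1 < n)%N -> 0 <= x i 0.
Proof.
move=> dx; have [m] := ubnP (n - i)%N.
elim: m i => // m IHm i lem lin; pose j := Ordinal lin.
apply: le_trans (dx i j erefl); case: ifPn => [//|jn].
have ltjn : (j.+1 < n)%N by rewrite ltn_neqAle jn /=.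
apply: IHm => //=; apply: leq_trans (lem : (n - i <= m)%N).
by rewrite ltn_sub2l // ltnW.
Qed.

Lemma nth_map_enum_ord (T : Type) (x0 : T) n (f : 'I_n -> T) (i : 'I_n) :
  nth x0 [seq f j | j <- enum 'I_n] i = f i.
Proof. by rewrite (nth_map i) ?size_enum_ord // nth_ord_enum. Qed.

Lemma sorted_norm_closed_chamberD (R : realType) n (x : 'cV[R]_n) :
  closed_chamberD x -> sorted >=%R [seq `|x i 0| | i <- enum 'I_n].
Proof.
move=> dx; apply/(sortedP 0) => k; rewrite size_map size_enum_ord => ltk.
have ltk' := ltnW ltk; pose i := Ordinal ltk'; pose j := Ordinal ltk.
rewrite (nth_map_enum_ord _ _ i) (nth_map_enum_ord _ _ j).
apply: le_trans (ler_norm (x i 0)).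
apply: le_trans (dx i j erefl); case: eqP => // /eqP jn.
rewrite ger0_norm // closed_chamberD_ge0 //.
by rewrite ltn_neqAle jn /=.
Qed.

(** The signs multiply to 1 because evenly many of them change. *)
Lemma weylD_prod (R : realType) n (w : 'M[R]_n) (x : 'cV[R]_n) :
  weylD w -> \prod_i (w *m x) i 0 = \prod_i x i 0.
Proof.
move=> /weylDP[a [s [_ a_prod ->]]].
rewrite [RHS](reindex_inj (@perm_inj _ s)) -[RHS]mul1r.
rewrite -[X in _ = X * _]a_prod -big_split /=.
by apply: eq_bigr => i _; rewrite -mulmxA mul_diag_mx -row_permE !mxE.
Qed.

Lemma weylD_norm (R : realType) n (w : 'M[R]_n) (x : 'cV[R]_n) : weylD w ->
  perm_eq [seq `|(w *m x) i 0| | i <- enum 'I_n]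
          [seq `|x i 0| | i <- enum 'I_n].
Proof.
move=> [e [s [_ ->]]].
rewrite (eq_map (g := (fun i => `|x i 0|) \o s)); last first.
  by move=> i; rewrite signed_perm_mxE normrM normr_sign mul1r.
rewrite map_comp; apply: perm_map; apply: uniq_perm.
- by rewrite map_inj_uniq ?enum_uniq //; apply: perm_inj.
- exact: enum_uniq.
by move=> i; rewrite mem_enum inE -[i](permKV s) map_f // mem_enum.
Qed.

(* Both vectors have the same sorted absolute values, which leaves only the sign
   of the last coordinate; the product of the coordinates is W-invariant and
   settles it. *)
Lemma closed_chamberD_uniq (R : realType) n (w : 'M[R]_n) (x : 'cV[R]_n) :
  weylD w -> closed_chamberD x -> closed_chamberD (w *m x) -> w *m x = x.
Proof.
move=> ww dx dy; set y := w *m x in dy *.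
have ge_tr : transitive (>=%R : rel R).
  by move=> ? ? ? h1 h2; apply: le_trans h1.
have eq_norm i : `|y i 0| = `|x i 0|.
  have : [seq `|y i 0| | i <- enum 'I_n] = [seq `|x i 0| | i <- enum 'I_n].
    apply: (@sorted_eq _ >=%R).
    - exact: ge_tr.
    - by move=> ? ? /andP[h1 h2]; apply/le_anti/andP.
    - exact: sorted_norm_closed_chamberD.
    - exact: sorted_norm_closed_chamberD.
    - exact: weylD_norm.
  by move=> /eq_in_map/(_ i); apply; rewrite mem_enum.
have eq_init (i : 'I_n) : (i.+1 < n)%N -> y i 0 = x i 0.
  move=> lti; have := eq_norm i.
  by rewrite !ger0_norm // closed_chamberD_ge0.
apply/colP => l; have [lt|gel] := ltnP l.+1 n; first exact: eq_init.
have ltn_l (i : 'I_n) : i != l -> (i.+1 < n)%N.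
  move=> il; apply: leq_trans (ltn_ord l); rewrite ltnS ltn_neqAle.
  by rewrite il /= -ltnS (leq_trans (ltn_ord i)).
have [xl0|xl0] := eqVneq (x l 0) 0.
  by apply/eqP; rewrite xl0 -normr_eq0 eq_norm xl0 normr0.
have := weylD_prod x ww; rewrite -/y (bigD1 l) //= [RHS](bigD1 l) //=.
rewrite (eq_bigr (fun i => x i 0)); last by move=> i /ltn_l/eq_init.
(* The other factors agree and can be cancelled: each has absolute value at least that of [x l 0],
   which is positive. *)
apply: mulIf; apply/prodf_neq0 => i il; rewrite -normr_eq0.
have lt_il : (i < l)%N by rewrite -ltnS (leq_trans (ltn_l _ il)).
have := sorted_ltn_nth ge_tr 0 (sorted_norm_closed_chamberD dx).
move=> /(_ i l); rewrite !inE size_map size_enum_ord.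
move=> /(_ (ltn_ord i) (ltn_ord l) lt_il).
rewrite !nth_map_enum_ord => le_li.
by rewrite gt_eqF // (lt_le_trans _ le_li) // normr_gt0.
Qed.

(* Take u in W_lambda maximizing <rho, u z>. A simple root a negative on u z
   would contradict this choice if <lambda, a> = 0, and the maximality of z if
   <lambda, a> > 0. *)
Lemma stab_conj_closed_chamberD (R : realType) n (c : R) (lambda z : 'cV[R]_n) :
    0 < c -> closed_chamberD lambda ->
    (forall w, weylD w ->
       killing_form c lambda (w *m z) <= killing_form c lambda z) ->
  exists2 u, weylD_stab lambda u & closed_chamberD (u *m z).
Proof.
move=> c0 /closed_chamberDP dl maxz.
(* This is the half-sum of the positive roots, (n-1, ..., 1, 0); it is strictly positive on every
   simple root. *)
pose rho : 'cV[R]_n := \col_i (n - i.+1)%:R.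
have [u [wu /eqP ul maxu]] := weylD_argmax
  (P := fun u => u *m lambda == lambda)
  (fun u => killing_form c rho (u *m z)) (weylD1 R n)
  (introT eqP (mul1mx lambda)).
exists u; first by [].
apply/closed_chamberDP => i j b ij bj; rewrite leNgt; apply/negP => neg.
have neq_ij : i != j by rewrite -val_eqE /= ij neq_ltn ltnSn.
have wr := weylD_reflD R b neq_ij.
have fix_u : killing_form c lambda (u *m z) = killing_form c lambda z.
  by rewrite -[in LHS]ul killing_form_tr mulmxA weylD_trmxV // mul1mx.
have rho_ij : (-1) ^+ b * rho j 0 < rho i 0.
  rewrite !mxE ij; case: (b) bj => [/(_ isT) jn|_].
    (* For the root e_i + e_j, [j] is the last index, where [rho] vanishes. *)
    have -> : (n - i.+2 = 0)%N by rewrite -ij jn subnn.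
    by rewrite mulr0 ltr0n subn_gt0 -ij.
  by rewrite mul1r ltr_nat ltn_sub2l // -ij.
have := dl i j b ij bj; rewrite le_eqVlt => /predU1P[lij|lij].
  have := maxu (reflD R b i j *m u) (weylDM wr wu).
  rewrite -mulmxA ul reflD_fix // eqxx => /(_ isT).
  rewrite -mulmxA killing_form_reflD // lerBlDr lerDl.
  by rewrite pmulr_rge0 // leNgt nmulr_llt0 ?subr_lt0 // subr_gt0 rho_ij.
have := maxz (reflD R b i j *m u) (weylDM wr wu).
rewrite -mulmxA killing_form_reflD // fix_u lerBlDr lerDl.
by rewrite pmulr_rge0 // leNgt nmulr_llt0 ?subr_lt0 // subr_gt0 lij.
Qed.

(** * The maximum over the orbit and the case of equality *)

(** The finite orbit has some maximizer [v *m Y]. An element [u] fixing [lambda] carries it into the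
    chamber, hence to [Y], without changing its pairing with [lambda]. *)
Lemma killing_form_max (R : realType) n (c : R) (lambda Y : 'cV[R]_n) w :
    0 < c -> closed_chamberD lambda -> closed_chamberD Y -> weylD w ->
  killing_form c lambda (w *m Y) <= killing_form c lambda Y.
Proof.
move=> c0 dl dY ww.
have [v [wv _ maxv]] := weylD_argmax (P := xpredT)
  (fun v => killing_form c lambda (v *m Y)) ww isT.
have [|u [wu ul] du] := @stab_conj_closed_chamberD _ _ c lambda (v *m Y) c0 dl.
  by move=> t wt; rewrite mulmxA; apply: maxv => //; apply: weylDM.
move: du; rewrite mulmxA => /(closed_chamberD_uniq (weylDM wu wv) dY) uvY.
rewrite -[in leRHS]uvY -[in leRHS]ul -mulmxA killing_form_tr mulmxA.
by rewrite weylD_trmxV // mul1mx maxv.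
Qed.

Theorem propositionA9 (R : realType) (n : nat) (hn : (2 <= n)%N)
    (c : R) (hc : 0 < c) (lambda Y : 'cV[R]_n) (w : 'M[R]_n)
    (hlambda : closed_chamberD lambda) (hY : closed_chamberD Y)
    (hw : weylD w) :
  killing_form c lambda (w *m Y) = killing_form c lambda Y <->
  mulmx_set (weylD_stab lambda) (weylD_stab Y) w.
Proof.
split=> [eq_max|[u [wu ul] [v [wv vY] <-]]]; last first.
  rewrite -mulmxA vY -[in LHS]ul killing_form_tr mulmxA.
  by rewrite weylD_trmxV // mul1mx.
have [|u [wu ul] du] :=
    @stab_conj_closed_chamberD _ _ c lambda (w *m Y) hc hlambda.
  move=> t wt; rewrite eq_max mulmxA.
  by apply: killing_form_max => //; apply: weylDM.
move: du; rewrite mulmxA => /(closed_chamberD_uniq (weylDM wu hw) hY) uwY.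
(* The transpose is the inverse of [u], so [w] factors as [u^T *m (u *m w)]. *)
exists u^T.
  split; first exact: weylD_tr.
  by rewrite -[in LHS]ul mulmxA weylD_trmxV // mul1mx.
exists (u *m w); first by split=> //; apply: weylDM.
by rewrite mulmxA weylD_trmxV // mul1mx.
Qed.
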